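(* Let $g\in SL(2,\mathbb{R})$ be $H$-reduced with $g(\infty)$ irrational, let $Q=Q_g$, and let $[a_0,a_1,\dots]$ be the minus continued fraction expansion of $g(\infty)$. For $n\in\mathbb{N}$ let $\alpha_n=\sum_{j=0}^{n-1}\log|a_j|$ and $\omega_n=\sum_{j=0}^{n-1}(\log|a_j|-\chi_j)$, and for $\delta>0$ let $$e(\delta,n)=\#\{0\le j\le n-1: |a_j|>2\delta^{-2}+\tfrac12+\lambda\},\qquad f(\delta,n)=\#\{0\le j\le n-1: |a_j|>2\delta^{-2}-\tfrac32+\lambda\}.$$ Let $c_0=\frac12\log(3\sqrt5)+\frac12\log(\frac34+\sqrt{\frac12})$. Let $0<\delta<\sqrt{2/\pi}$ and $\kappa>0$, and for $\rho>0$ let $$G(\rho)=\{p\in\mathfrak p: 0<|Q(p)|<\tfrac12\delta^2,\ L_g^-(p)>\kappa,\ \|p\|\le\rho\}.$$ Then there exist constants $\theta\ge0$ and $\nu\in\mathbb{N}$ such that for all $n\in\mathbb{N}$ and $\rho>0$: (i) if $\log\rho\ge\alpha_n+c_0n+\theta$ then $\#G(\rho)\ge e(\delta,n)-\nu$; (ii) if $\log\rho\le\omega_n-\theta$ then $\#G(\rho)\le f(\delta,n)+\nu$.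
   Context: $SL(2,\mathbb{R})$ acts on $\mathbb{H}^2\cup\mathbb{R}\cup\{\infty\}$ by Möbius transformations; $a_t=\mathrm{diag}(e^{t/2},e^{-t/2})$. $g$ is $H$-reduced if the geodesic $t\mapsto ga_t(i)$, whose repelling endpoint is $g(0)$ and attracting endpoint is $g(\infty)$, is $H$-reduced, where a geodesic with repelling endpoint $u$ and attracting endpoint $w$ is $H$-reduced if $|w|>2$ and $\mathrm{sgn}(w)u\in[\lambda-1,\lambda]$, with $\lambda=\frac12(3-\sqrt5)$. $\mu=(23-3\sqrt5)/22$; $d$ is hyperbolic distance in $\mathbb{H}^2$ (metric $|dz|/\mathrm{Im}\,z$); $\chi_j=\frac12\log(3\sqrt5)$ if $|a_j|\ge3$ and $\chi_j=\log2-\frac12 d(\mu+i\sqrt{1-\mu^2},\frac12(3+i\sqrt3))$ if $|a_j|=2$. Minus continued fraction: every irrational $\xi$ is uniquely $[a_0,a_1,\dots]=a_0-1/(a_1-1/(a_2-\cdots))$ with $a_j\in\mathbb{Z}$, $|a_j|\ge2$, $a_ja_{j+1}<0$ whenever $|a_j|=2$. $Q_g(v)=Q_0(g^{-1}v)$ with $Q_0(xe_1+ye_2)=xy$; writing $g^{-1}v=xe_1+ye_2$, $L_g^-(v)=x$. $\mathfrak p$ is the set of primitive integral pairs, $\|\cdot\|$ the Euclidean norm. *)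

(* Defs.v *)
From HB Require Import structures.
From mathcomp Require Import all_boot all_order all_algebra.
From mathcomp Require Import all_classical all_reals all_analysis.

From mathcomp Require Import zify.

Set Implicit Arguments.
Unset Strict Implicit.
Unset Printing Implicit Defensive.

Import Order.TTheory GRing.Theory Num.Theory.
Import numFieldNormedType.Exports.

Local Open Scope classical_set_scope.
Local Open Scope ring_scope.

(* Action of a matrix on the boundary circle R U {oo}, encoded as [option R]
   with [None] the point at infinity. *)
Definition mobius_bd (R : realType) (g : 'M[R]_2) (z : option R) : option R :=
  match z with
  | Some x =>
      if g 1 0 * x + g 1 1 == 0 then None
      else Some ((g 0 0 * x + g 0 1) / (g 1 0 * x + g 1 1))
  | None => if g 1 0 == 0 then None else Some (g 0 0 / g 1 0)
  end.

Definition Hlambda (R : realType) : R := (3 - Num.sqrt 5) / 2.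

(* [u] is the repelling and [w] the attracting endpoint; a geodesic with an
   endpoint at infinity is not reduced. *)
Definition Hreduced_geodesic (R : realType) (u w : option R) : Prop :=
  match u, w with
  | Some x, Some y =>
      2 < `|y| /\ Hlambda R - 1 <= Num.sg y * x <= Hlambda R
  | _, _ => False
  end.

(* The geodesic t |-> g a_t (i) runs from g(0) to g(oo). *)
Definition Hreduced (R : realType) (g : 'M[R]_2) : Prop :=
  Hreduced_geodesic (mobius_bd g (Some 0)) (mobius_bd g None).

(* [a_0, ..., a_n] = a_0 - 1 / [a_1, ..., a_n] *)
Fixpoint mcf_convergent (R : realType) (a : nat -> int) (n : nat) : R :=
  match n with
  | 0%N => (a 0%N)%:~R
  | n'.+1 => (a 0%N)%:~R - (mcf_convergent R (fun j => a j.+1) n')^-1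
  end.

Definition is_minus_cf (R : realType) (a : nat -> int) (xi : R) : Prop :=
  [/\ forall j, 2 <= `|a j|,
      forall j, `|a j| = 2 -> a j * a j.+1 < 0
    & mcf_convergent R a n @[n --> \oo] --> xi].

(* Points and paths of the upper half-plane are given by their real and
   imaginary parts.  The derivative of a path may vanish, so that every
   piecewise C^1 path has a C^1 reparametrization of the same length. *)
Definition hyp_length (R : realType) (x y : R -> R) : R :=
  \int[@lebesgue_measure R]_(t in `[0, 1])
    (Num.sqrt (derive1 x t ^+ 2 + derive1 y t ^+ 2) / y t).

Definition hyp_path (R : realType) (z w : R * R) (x y : R -> R) : Prop :=
  [/\ (forall t, derivable x t 1) /\ (forall t, derivable y t 1),
      continuous (derive1 x) /\ continuous (derive1 y),
      forall t, 0 <= t <= 1 -> 0 < y t,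
      (x 0, y 0) = z
    & (x 1, y 1) = w].

Definition hyp_dist (R : realType) (z w : R * R) : R :=
  inf [set l | exists x y : R -> R, hyp_path z w x y /\ l = hyp_length x y].

Definition Hmu (R : realType) : R := (23 - 3 * Num.sqrt 5) / 22.

(* Only the values |a| = 2 and |a| >= 3 occur. *)
Definition chi (R : realType) (a : int) : R :=
  if 3 <= `|a| then ln (3 * Num.sqrt 5) / 2
  else ln 2 - hyp_dist (Hmu R, Num.sqrt (1 - Hmu R ^+ 2))
                       (3 / 2, Num.sqrt 3 / 2) / 2.

Definition log_abs (R : realType) (a : int) : R := ln (`|a|%:~R).

Definition alpha (R : realType) (a : nat -> int) (n : nat) : R :=
  \sum_(j < n) log_abs R (a j).

Definition omega (R : realType) (a : nat -> int) (n : nat) : R :=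
  \sum_(j < n) (log_abs R (a j) - chi R (a j)).

Definition e_count (R : realType) (a : nat -> int) (delta : R) (n : nat) : nat :=
  #|[pred j : 'I_n |
      2 * delta ^- 2 + 2^-1 + Hlambda R < (`|a j|%:~R : R)]|.

Definition f_count (R : realType) (a : nat -> int) (delta : R) (n : nat) : nat :=
  #|[pred j : 'I_n |
      2 * delta ^- 2 - 3 / 2 + Hlambda R < (`|a j|%:~R : R)]|.

Definition c0 (R : realType) : R :=
  ln (3 * Num.sqrt 5) / 2 + ln (3 / 4 + Num.sqrt 2^-1) / 2.

Definition Q0 (R : realType) (v : 'cV[R]_2) : R := v 0 0 * v 1 0.

Definition Qform (R : realType) (g : 'M[R]_2) (v : 'cV[R]_2) : R :=
  Q0 (invmx g *m v).

Definition Lminus (R : realType) (g : 'M[R]_2) (v : 'cV[R]_2) : R :=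
  (invmx g *m v) 0 0.

Definition enorm (R : realType) (v : 'cV[R]_2) : R :=
  Num.sqrt (v 0 0 ^+ 2 + v 1 0 ^+ 2).

Definition primitive_pairs : set (int * int) := [set p | coprimez p.1 p.2].

Definition pair_vec (R : realType) (p : int * int) : 'cV[R]_2 :=
  \col_(i < 2) (if i == 0 then p.1%:~R else p.2%:~R).

Definition Gset (R : realType) (g : 'M[R]_2) (delta kappa rho : R) :
    set (int * int) :=
  [set p | [/\ primitive_pairs p,
               0 < `|Qform g (pair_vec R p)| < delta ^+ 2 / 2,
               kappa < Lminus g (pair_vec R p)
             & enorm (pair_vec R p) <= rho]].

(* In particular [fset_set (Gset g delta kappa rho)] has the same elements
   as [Gset g delta kappa rho]. *)
Lemma finite_Gset (R : realType) (g : 'M[R]_2) (delta kappa rho : R) :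
  finite_set (Gset g delta kappa rho).
Proof.
have [s bnd] : exists s : seq int,
    forall m : int, `|m%:~R : R| <= rho -> m \in s.
  pose B := Num.truncn `|rho|.
  exists [seq i%:Z - B%:Z | i <- iota 0 (B + B).+1] => m h.
  have hm : (absz m <= B)%N.
    rewrite /B -ltnS -(ltr_nat R); apply: le_lt_trans (truncnS_gt _).
    by rewrite pmulrn abszE intr_norm (le_trans h) // ler_norm.
  apply/mapP; exists (absz (m + B%:Z)); last by lia.
  by rewrite mem_iota add0n ltnS; lia.
apply: (@sub_finite_set _ _ [set` [seq (i, j) | i <- s, j <- s]]).
  move=> [x y] [_ _ _]; rewrite /enorm !mxE /= => h.
  apply/allpairsP; exists (x, y); split => //=; apply: bnd.
    by apply: (le_trans _ h); rewrite -sqrtr_sqr ler_wsqrtr ?lerDl ?sqr_ge0.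
  by apply: (le_trans _ h); rewrite -sqrtr_sqr ler_wsqrtr ?lerDr ?sqr_ge0.
exact: finite_seq.
Qed.

(* Main.v *)
Require Import Defs.
From HB Require Import structures.
From mathcomp Require Import all_boot all_order all_algebra finmap.
From mathcomp Require Import all_classical all_reals all_analysis.
From mathcomp Require Import ring lra zify.
Import Order.TTheory GRing.Theory Num.Theory.
Import numFieldNormedType.Exports.
Local Open Scope classical_set_scope.
Local Open Scope ring_scope.

(* Let [w_n], [u_n] be the images of the endpoints [w = g(oo)], [u = g(0)] under
   the coding [z |-> 1 / (a_n - z)], and [E_n] the integral vector of the n-th
   convergent.  The first coordinate of [g^-1 E_n] is multiplied by [a_n - u_n]
   at each step, and [|Q(E_n)| = 1 / |w_n - u_n|], where [|a_n - w_n| <= 1/2] and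
   [u_n] stays in the interval of reducedness.  Hence [E_n] has a small value of
   [Q] exactly when [a_n] is large, up to the shift between [e] and [f], while the
   product of the [|a_n - u_n|] lies between [exp omega_n] and
   [exp (alpha_n + c0 n)] up to constants.  Conversely, a Legendre-type argument
   shows that a primitive vector with [|Q| <= 1/3] whose first coordinate is at
   least that of [E_0] is one of the [E_n] up to sign; [pi >= 3] makes this
   threshold sufficient. *)

Set Implicit Arguments.
Unset Strict Implicit.
Unset Printing Implicit Defensive.

(** * Numerical constants and the hyperbolic distance *)

Lemma sqrt_between (R : realType) (p q x : R) :
  0 <= p -> 0 <= q -> p ^+ 2 <= x <= q ^+ 2 -> p <= Num.sqrt x <= q.
Proof.
move=> p0 q0 /andP[px xq].
by rewrite -(ger0_norm p0) -(ger0_norm q0) -!sqrtr_sqr !ler_wsqrtr.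
Qed.

Lemma sqrt5_bounds (R : realType) :
  2236 / 1000 <= Num.sqrt (5 : R) <= 2237 / 1000.
Proof. by apply: sqrt_between; lra. Qed.

(** This quadratic relation yields [1/(3 - lambda) = lambda] and [1/(2 - lambda) = 1 - lambda], the
    two identities that keep the interval of reducedness stable under the coding. *)
Lemma Hlambda_sqr (R : realType) : Hlambda R ^+ 2 = 3 * Hlambda R - 1.
Proof.
have h : Num.sqrt (5 : R) ^+ 2 = 5 by rewrite sqr_sqrtr.
by rewrite /Hlambda; move: (Num.sqrt _) h => s h; lra.
Qed.

Lemma Hlambda_bounds (R : realType) : 19 / 50 <= Hlambda R <= 2 / 5.
Proof. by have := sqrt5_bounds R; rewrite /Hlambda; lra. Qed.

(** With [x = pi/6] and [s = sin x], the triple angle formula turns [sin (3x) = 1] into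
    [(s + 1)(2s - 1)^2 = 0], hence [s = 1/2]; the mean value theorem then gives [s <= x]. *)
Lemma pi_ge3 (R : realType) : 3 <= pi :> R.
Proof.
set x : R := pi / 6.
have p0 := pi_gt0 R.
have x0 : 0 < x by rewrite /x; lra.
have s0 : 0 < sin x by apply: sin_gt0_pi; rewrite /x; lra.
have sx : sin x = 2^-1.
  have : sin (x + x *+ 2) = 1.
    by rewrite -(sin_pihalf R); congr (sin _); rewrite /x; lra.
  rewrite sinD sin_mulr2n cos_mulr2n => h.
  have c2s : cos x ^+ 2 * sin x = (1 - sin x ^+ 2) * sin x.
    by rewrite -(cos2Dsin2 x) addrK.
  have h3 : (sin x + 1) * (2 * sin x - 1) ^+ 2 = 0 by lra.
  move/eqP: h3; rewrite mulf_eq0 expf_eq0 /= => /orP[/eqP|/eqP]; lra.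
have [c cx] : exists2 c : R, c \in `]0, x[ & sin x - sin 0 = cos c * (x - 0).
  apply: MVT => //; apply: continuous_subspaceT => t.
  exact: continuous_sin.
rewrite sin0 !subr0 sx => e.
suff : 2^-1 <= x by rewrite /x; lra.
by rewrite e ler_piMl ?cos_le1 // ltW.
Qed.

Lemma ln_3sqrt5_ge (R : realType) : 2 * ln 2 <= ln (3 * Num.sqrt (5 : R)).
Proof.
have /andP[s5 _] := sqrt5_bounds R.
by rewrite mulrDl !mul1r -lnM ?posrE // ler_ln ?posrE; lra.
Qed.

(** The upper growth estimate uses [c0] only through [2 <= exp c0]. *)
Lemma c0_ge (R : realType) : ln 2 <= c0 R.
Proof.
have /andP[s5 _] := sqrt5_bounds R.
have s2 : 1 / 2 <= Num.sqrt (2^-1 : R).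
  by have /andP[] : 1 / 2 <= Num.sqrt (2^-1 : R) <= 1 by apply: sqrt_between; lra.
have h1 := ln_3sqrt5_ge R.
have h2 : 0 <= ln (3 / 4 + Num.sqrt (2^-1 : R)) by apply: ln_ge0; lra.
by rewrite /c0; lra.
Qed.

(** Lengths are nonnegative, so the set of lengths is bounded below and its [inf] is a genuine lower
    bound. *)
Lemma hyp_dist_le_length (R : realType) (z w : R * R) (x y : R -> R) :
  hyp_path z w x y -> hyp_dist z w <= hyp_length x y.
Proof.
move=> xy; apply: ge_inf; last by exists x, y.
exists 0 => _ [x' [y' [[_ _ y0 _ _] ->]]].
apply: Rintegral_ge0 => //= t; rewrite in_itv /= => t01.
by rewrite divr_ge0 ?sqrtr_ge0 // ltW // y0.
Qed.

Lemma Hmu_bounds (R : realType) : 37 / 50 <= Hmu R <= 3 / 4.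
Proof. by have := sqrt5_bounds R; rewrite /Hmu; lra. Qed.

Lemma derive1_affine (R : realType) (p q t : R) :
  derive1 (fun s : R => p + q * s) t = q.
Proof.
rewrite derive1E deriveD // derive_cst add0r.
by rewrite deriveM // derive_cst derive_id; rewrite /GRing.scale /=; lra.
Qed.

(* The Euclidean segment suffices: its hyperbolic length is at most its
   Euclidean length divided by the smaller of the two heights. *)
Lemma hyp_dist_le_segment (R : realType) (x0 y0 x1 y1 L : R) :
  0 < y0 -> y0 <= y1 -> (x1 - x0) ^+ 2 + (y1 - y0) ^+ 2 <= (L * y0) ^+ 2 ->
  0 <= L -> hyp_dist (x0, y0) (x1, y1) <= L.
Proof.
move=> y0_gt0 y01 hL L0.
pose x (t : R) := x0 + (x1 - x0) * t; pose y (t : R) := y0 + (y1 - y0) * t.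
have dx t : derive1 x t = x1 - x0 by exact: derive1_affine.
have dy t : derive1 y t = y1 - y0 by exact: derive1_affine.
have y_ge t : 0 <= t -> y0 <= y t.
  by move=> t0; rewrite /y lerDl mulr_ge0 // subr_ge0.
have path : hyp_path (x0, y0) (x1, y1) x y.
  split.
  - by split=> t; rewrite /x /y.
  - rewrite (_ : derive1 x = cst (x1 - x0)); last exact/funext.
    rewrite (_ : derive1 y = cst (y1 - y0)); last exact/funext.
    by split=> t; exact: cst_continuous.
  - by move=> t /andP[t0 _]; apply: lt_le_trans (y_ge _ t0).
  - by rewrite /x /y !mulr0 !addr0.
  - by rewrite /x /y !mulr1; congr pair; ring.
apply: le_trans (hyp_dist_le_length path) _.
rewrite /hyp_length.
under eq_Rintegral do rewrite dx dy.
set s := Num.sqrt _.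
have sL : s <= L * y0.
  rewrite -[leRHS]ger0_norm ?mulr_ge0 ?(ltW y0_gt0) //.
  by rewrite -sqrtr_sqr ler_wsqrtr.
apply: (@le_trans _ _ (\int[@lebesgue_measure R]_(t in `[0, 1]) L)); last first.
  by rewrite Rintegral_cst //= lebesgue_measure_itv /= lte_fin ltr01 oppr0 adde0 mulr1.
have cf (t : R) : 0 <= t -> {for t, continuous (fun r : R => s / y r)}.
  move=> t0; apply: (@continuousM _ _ (cst s)); first exact: cst_continuous.
  apply: continuousV; first by rewrite gt_eqF // (lt_le_trans y0_gt0) // y_ge.
  by apply/differentiable_continuous/derivable1_diffP; rewrite /y.
apply: le_Rintegral => //.
- apply: continuous_compact_integrable; first exact: segment_compact.
  apply/continuous_in_subspaceT => t; rewrite inE /= in_itv /= => /andP[t0 _].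
  exact: cf.
- apply: continuous_compact_integrable; first exact: segment_compact.
  by apply: continuous_subspaceT => t; exact: cst_continuous.
- move=> t /=; rewrite in_itv /= => /andP[t0 _].
  have yt := y_ge _ t0.
  rewrite ler_pdivrMr ?(lt_le_trans y0_gt0) //.
  by rewrite (le_trans sL) // ler_wpM2l.
Qed.

(** For [|a| = 2] the difference [log |a| - chi] is half this distance, so an upper bound on the
    distance is what controls [omega]. Rational enclosures of the two endpoints are precise
    enough. *)
Lemma chi2_dist_le (R : realType) :
  hyp_dist (Hmu R, Num.sqrt (1 - Hmu R ^+ 2)) (3 / 2, Num.sqrt 3 / 2) <= 6 / 5.
Proof.
move: (Hmu R) (Hmu_bounds R) => m /andP[m1 m2].
have /andP[m3 m4] : 7 / 16 <= 1 - m ^+ 2 <= 23 / 50.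
  by apply/andP; split; nra.
have /andP[s1 s2] : 33 / 50 <= Num.sqrt (1 - m ^+ 2) <= 17 / 25.
  by apply: sqrt_between; lra.
have /andP[r1 r2] : 12 / 7 <= Num.sqrt (3 : R) <= 7 / 4.
  by apply: sqrt_between; lra.
move: s1 s2 r1 r2; move: (Num.sqrt 3) (Num.sqrt _) => r s s1 s2 r1 r2.
have hx : (3 / 2 - m) ^+ 2 <= (19 / 25) ^+ 2.
  by rewrite ler_pXn2r // ?nnegrE; lra.
have hy : (r / 2 - s) ^+ 2 <= (43 / 200) ^+ 2.
  by rewrite ler_pXn2r // ?nnegrE; lra.
have hL : (6 / 5 * (33 / 50)) ^+ 2 <= (6 / 5 * s) ^+ 2.
  by rewrite ler_pXn2r // ?nnegrE; lra.
by apply: hyp_dist_le_segment; lra.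
Qed.

(** From [exp (-3/20) >= 17/20] one gets [exp (3/20) <= 20/17], and the fourth power of [20/17] is
    below 2. *)
Lemma expR_le2 (R : realType) : expR (3 / 5) <= 2 :> R.
Proof.
have h : 17 / 20 <= expR (- (3 / 20)) :> R.
  by apply: le_trans (expR_ge1Dx _); lra.
have -> : 3 / 5 = 3 / 20 + 3 / 20 + (3 / 20 + 3 / 20) :> R by lra.
rewrite !expRD; have : expR (3 / 20) * expR (- (3 / 20)) = 1 :> R.
  by rewrite expRxMexpNx_1.
have : 0 < expR (3 / 20) :> R by apply: expR_gt0.
move: (expR _) h (expR _) => e h f f0 fe.
have f1 : f <= 20 / 17 by nra.
have f2 : f * f <= 400 / 289 by nra.
nra.
Qed.

Lemma log_abs_chi_le (R : realType) (a : int) : 2 <= `|a| ->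
  expR (log_abs R a - chi R a) <=
    (if 3 <= `|a| then `|a|%:~R / 2 else 2).
Proof.
move=> a2; rewrite /chi /log_abs.
have a0 : 0 < (`|a|%:~R : R) by rewrite ltr0z; lia.
case: ifPn => [_|]; last first.
  rewrite -ltNge => a3; have -> : `|a| = 2 by lia.
  rewrite opprB addrC subrK.
  apply: le_trans (expR_le2 R); rewrite ler_expR.
  by have := chi2_dist_le R; lra.
rewrite -[leRHS](@lnK R) ?posrE ?divr_gt0 // ler_expR ln_div ?posrE //.
by have := ln_3sqrt5_ge R; lra.
Qed.

(** * Tails of minus continued fractions *)

Definition minus_digits (a : nat -> int) :=
  (forall j, 2 <= `|a j|) /\ (forall j, `|a j| = 2 -> a j * a j.+1 < 0).

Lemma digit_sign (R : realType) (a : int) : 2 <= `|a| ->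
  0 < a /\ (sgz a)%:~R = 1 :> R /\ (2 <= a%:~R :> R) \/
  a < 0 /\ (sgz a)%:~R = -1 :> R /\ (a%:~R <= -2 :> R).
Proof.
move=> a2; case: (ltrgtP a 0) => a0; last by exfalso; lia.
- right; have : a <= -2 by lia.
  by rewrite ltr0_sgz // mulrN1z -(ler_int R) => h; split=> //; split=> //; lra.
- left; have : 2 <= a by lia.
  by rewrite gtr0_sgz // -(ler_int R) => h; split=> //; split=> //; lra.
Qed.

(* The tail [x] of an expansion with leading digit [a], on the side and at the
   distance from [a] which are forced by the digit rules. *)
Definition tail_bounds (R : realType) (a : int) (x : R) :=
  2 <= (sgz a)%:~R * x /\ `|a%:~R - x| <= 2^-1.

(** The inverse of [x] has the sign of [b] and absolute value at most 1/2. If [|a| >= 3],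
    subtracting it leaves a number of absolute value at least 5/2; if [|a| = 2], the sign rule makes
    the subtraction move away from zero. *)
Lemma tail_bounds_step (R : realType) (a b : int) (x : R) :
  2 <= `|a| -> 2 <= `|b| -> (`|a| = 2 -> a * b < 0) ->
  tail_bounds b x -> tail_bounds a (a%:~R - x^-1).
Proof.
move=> a2 b2 ab [bx _].
have xV : x^-1 * x = 1.
  by rewrite mulVf //; apply: contraTneq bx => ->; rewrite mulr0; lra.
move: (x^-1) xV => y xV.
have bxV : 0 < (sgz b)%:~R * y <= 2^-1.
  case: (digit_sign R b2) bx => -[_ [-> _]] bx; apply/andP; split; nra.
split; last first.
  rewrite opprB addrC subrK.
  case: (digit_sign R b2) bxV => -[_ [-> _]] /andP[? ?];
    by rewrite ler_norml; apply/andP; split; lra.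
have [a3|a3] : 3 <= `|a| \/ `|a| = 2 by lia.
  have {}a3 : 3 <= `|a%:~R : R| by rewrite -intr_norm (ler_int R 3).
  case: (digit_sign R a2) a3 => -[a0 [-> ha]]; [rewrite gtr0_norm|rewrite ltr0_norm];
  rewrite ?ltr0z ?ltrz0 // => a3;
  case: (digit_sign R b2) bxV => -[_ [-> _]] /andP[? ?]; lra.
have := ab a3; move: bxV.
case: (digit_sign R a2) => -[a0 [-> ha]] + ab0.
  move: ab0; rewrite pmulr_rlt0 // => b0; rewrite ltr0_sgz // mulrN1z; lra.
move: ab0; rewrite nmulr_rlt0 // => b0; rewrite gtr0_sgz //; lra.
Qed.

Lemma tail_bounds_digit (R : realType) (a : int) :
  2 <= `|a| -> tail_bounds a (a%:~R : R).
Proof.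
move=> a2; split; last by rewrite subrr normr0 invr_ge0.
by case: (digit_sign R a2) => -[_ [-> h]]; lra.
Qed.

Lemma tail_bounds_convergent (R : realType) (a : nat -> int) (n : nat) :
  minus_digits a -> tail_bounds (a 0%N) (mcf_convergent R a n).
Proof.
elim: n a => [|n IHn] a [a2 ab] /=; first exact: tail_bounds_digit.
apply: (@tail_bounds_step _ _ (a 1%N)) => //; first exact: ab.
by apply: (IHn (fun j => a j.+1)); split=> j; [exact: a2|exact: ab].
Qed.

Lemma tail_bounds_lim (R : realType) (a : int) (u : R^nat) (x : R) :
  u @ \oo --> x -> (forall n, tail_bounds a (u n)) -> tail_bounds a x.
Proof.
move=> ux ua; split.
  have h : (fun n => (sgz a)%:~R * u n) @ \oo --> (sgz a)%:~R * x.
    by apply: cvgM => //; exact: cvg_cst.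
  rewrite -(cvg_lim _ h) //; apply: limr_ge.
    by apply/cvg_ex; exists ((sgz a)%:~R * x).
  by apply: nearW => n; case: (ua n).
have h : (fun n => `|a%:~R - u n|) @ \oo --> `|a%:~R - x|.
  by apply: cvg_norm; apply: cvgB => //; exact: cvg_cst.
rewrite -(cvg_lim _ h) //; apply: limr_le; first by apply/cvg_ex; exists (`|a%:~R - x|).
by apply: nearW => n; case: (ua n).
Qed.

Lemma irrational_digit_sub (R : realType) (a : int) (x : R) :
  irrational x -> a%:~R - x != 0 /\ irrational (a%:~R - x)^-1.
Proof.
move=> xQ; split.
  by apply: contra_notN xQ; rewrite subr_eq0 => /eqP <-; exists a%:~R; rewrite ?ratr_int.
move=> [q _ qx]; apply: xQ; exists (a%:~R - q^-1) => //.
have qV : ratr q^-1 = (ratr q)^-1 :> R by exact: fmorphV.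
by rewrite rmorphB /= ratr_int qV qx invrK; ring.
Qed.

(** The map [z -> 1/(a_0 - z)] is continuous at an irrational [x] and removes the leading digit of
    each convergent. *)
Lemma is_minus_cf_tail (R : realType) (a : nat -> int) (x : R) :
  is_minus_cf a x -> irrational x ->
  is_minus_cf (fun j => a j.+1) ((a 0%N)%:~R - x)^-1.
Proof.
move=> [a2 ab ax] xQ; split=> [j|j|]; [exact: a2|exact: ab|].
have [ax0 _] := irrational_digit_sub (a 0%N) xQ.
have ax1 : (fun n => mcf_convergent R a n.+1) @ \oo --> x.
  by move: ax; rewrite -(cvg_shiftS (mcf_convergent R a)).
have E n : mcf_convergent R (fun j => a j.+1) n =
    ((a 0%N)%:~R - mcf_convergent R a n.+1)^-1.
  by rewrite /= opprB addrC subrK invrK.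
under eq_cvg do rewrite E.
by apply: cvgV => //; apply: cvgB => //; exact: cvg_cst.
Qed.

Lemma tail_bounds_cf (R : realType) (a : nat -> int) (x : R) :
  is_minus_cf a x -> tail_bounds (a 0%N) x.
Proof.
move=> [a2 ab ax]; apply: (tail_bounds_lim ax) => n.
exact: tail_bounds_convergent.
Qed.

(** The start [z] is independent of the digits: the expansion of the attracting endpoint drives the
    orbits of both endpoints. *)
Fixpoint mcf_orbit (R : realType) (a : nat -> int) (z : R) (n : nat) : R :=
  if n is m.+1 then ((a m)%:~R - mcf_orbit a z m)^-1 else z.

Lemma is_minus_cf_orbit (R : realType) (a : nat -> int) (x : R) (n : nat) :
  is_minus_cf a x -> irrational x ->
  is_minus_cf (fun j => a (n + j)%N) (mcf_orbit a x n) /\ irrational (mcf_orbit a x n).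
Proof.
move=> ax xQ; elim: n => [//|n [IHa IHQ]] /=.
have [_ ?] := irrational_digit_sub (a n) IHQ; split=> //.
have := is_minus_cf_tail IHa IHQ; rewrite addn0.
by congr is_minus_cf; apply/funext => j; rewrite addnS addSn.
Qed.

Definition Hinterval (R : realType) (a : int) (u : R) :=
  Hlambda R - 1 <= (sgz a)%:~R * u <= Hlambda R.

(** If [|a| >= 3] then [|a - u| >= 3 - lambda], so the inverse lies in [[-lambda, lambda]]. If
    [|a| = 2] the inverse is at most [1/(2 - lambda) = 1 - lambda] in absolute value, and the sign
    rule puts it on the side opposite to [b], where the interval extends that far. *)
Lemma Hinterval_step (R : realType) (a b : int) (u : R) :
  2 <= `|a| -> 2 <= `|b| -> (`|a| = 2 -> a * b < 0) ->
  Hinterval a u -> Hinterval b (a%:~R - u)^-1.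
Proof.
rewrite /Hinterval => a2 b2 ab.
move: (Hlambda R) (Hlambda_sqr R) (Hlambda_bounds R) => l l2 /andP[l0 l1].
have inv_le (c d : R) : 0 < c -> c <= d -> 0 < d^-1 <= c^-1.
  by move=> c0 cd; rewrite invr_gt0 lef_pV2 ?posrE ?(lt_le_trans c0) // cd.
have n3 : 3 - l != 0 by rewrite gt_eqF; lra.
have n2 : 2 - l != 0 by rewrite gt_eqF; lra.
have l3 : (3 - l)^-1 = l by apply: (mulfI n3); rewrite mulfV //; lra.
have l2V : (2 - l)^-1 = 1 - l by apply: (mulfI n2); rewrite mulfV //; lra.
have [a3|a3] : 3 <= `|a| \/ `|a| = 2 by lia.
  have {}a3 : 3 <= `|a%:~R : R| by rewrite -intr_norm (ler_int R 3).
  case: (digit_sign R a2) a3 => -[a0 [-> ha]] + /andP[u0 u1].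
    rewrite gtr0_norm ?ltr0z // => a3.
    have /andP[] : 0 < (a%:~R - u)^-1 <= (3 - l)^-1 by apply: inv_le; lra.
    by case: (digit_sign R b2) => -[_ [-> _]]; lra.
  rewrite ltr0_norm ?ltrz0 // => a3; rewrite -[_ - u]opprK invrN.
  have /andP[] : 0 < (- (a%:~R - u))^-1 <= (3 - l)^-1 by apply: inv_le; lra.
  by case: (digit_sign R b2) => -[_ [-> _]]; lra.
have ha2 : `|a%:~R : R| = 2 by rewrite -intr_norm a3.
have := ab a3.
case: (digit_sign R a2) => -[a0 [-> _]] ab0 /andP[u0 u1].
  move: ab0; rewrite pmulr_rlt0 // => b0; rewrite ltr0_sgz // mulrN1z.
  move: ha2; rewrite gtr0_norm ?ltr0z // => ->.
  have /andP[] : 0 < (2 - u)^-1 <= (2 - l)^-1 by apply: inv_le; lra.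
  lra.
move: ab0; rewrite nmulr_rlt0 // => b0; rewrite gtr0_sgz //.
move: ha2; rewrite ltr0_norm ?ltrz0 // => ha2; rewrite -[_ - u]opprK invrN.
have /andP[] : 0 < (- (a%:~R - u))^-1 <= (2 - l)^-1 by apply: inv_le; lra.
lra.
Qed.

(* The state (a_n, w_n, u_n) of the coding of the geodesic from [u] to [w]. *)
Definition reduced_digit (R : realType) (a : int) (w u : R) :=
  [/\ 2 <= `|a|, tail_bounds a w & Hinterval a u].

Lemma reduced_digit_orbit (R : realType) (a : nat -> int) (x u : R) (n : nat) :
  is_minus_cf a x -> irrational x ->
  Hlambda R - 1 <= Num.sg x * u <= Hlambda R ->
  reduced_digit (a n) (mcf_orbit a x n) (mcf_orbit a u n).
Proof.
move=> ax xQ xu; have [a2 ab _] := ax; split=> //.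
  have [+ _] := is_minus_cf_orbit n ax xQ.
  by move/tail_bounds_cf; rewrite addn0.
elim: n => [|n IHn] /=; last by apply: Hinterval_step => //; exact: ab.
have [sx _] := tail_bounds_cf ax; rewrite /Hinterval.
suff <- : Num.sg x = (sgz (a 0%N))%:~R by [].
case: (digit_sign R (a2 0%N)) sx => -[_ [-> _]] sx.
  by rewrite gtr0_sg //; lra.
by rewrite ltr0_sg //; lra.
Qed.

(** * Convergents in reduced coordinates *)

Lemma reduced_digit_gap (R : realType) (a : int) (w u : R) :
  reduced_digit a w u ->
  `|a|%:~R - Hlambda R <= `|a%:~R - u| <= `|a|%:~R + 1 - Hlambda R.
Proof.
move=> [a2 _ /andP[u0 u1]]; have /andP[l0 l1] := Hlambda_bounds R.
rewrite intr_norm; case: (digit_sign R a2) u0 u1 => -[_ [-> ha]] u0 u1.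
  by rewrite !gtr0_norm; lra.
by rewrite !ltr0_norm; lra.
Qed.

(** These two bounds are the source of the shifts [1/2 + lambda] and [-3/2 + lambda] in the
    thresholds of [e_count] and [f_count]. *)
Lemma reduced_digit_width (R : realType) (a : int) (w u : R) :
  reduced_digit a w u ->
  `|a|%:~R - 2^-1 - Hlambda R <= `|w - u| <= `|a|%:~R + 3 / 2 - Hlambda R.
Proof.
move=> [a2 [wa aw] /andP[u0 u1]]; have /andP[l0 l1] := Hlambda_bounds R.
rewrite intr_norm.
move: aw; rewrite ler_norml => /andP[w0 w1].
case: (digit_sign R a2) wa u0 u1 => -[_ [-> ha]] wa u0 u1.
  by rewrite !gtr0_norm; lra.
by rewrite !ltr0_norm; lra.
Qed.

(* In the coordinates of the n-th convergent basis the form is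
   (s - u t) (s - w t) / (w - u) up to sign. *)
Lemma legendre_coord_pos (R : realType) (a s t : int) (w u : R) :
  0 < a -> 0 < t -> reduced_digit a w u ->
  1 <= `|s%:~R - u * t%:~R| < a%:~R - u ->
  (w - u) / 3 < `|(s%:~R - u * t%:~R) * (s%:~R - w * t%:~R)|.
Proof.
move=> a0 t0 [a2 [wa aw] +]; rewrite /Hinterval.
move: wa aw; rewrite gtr0_sgz // !mul1r ler_norml => w2 /andP[aw0 aw1].
have /andP[] := Hlambda_bounds R; move: (Hlambda R) => l l0 l1 /andP[u0 u1].
have A3 : a%:~R = 2 :> R \/ 3 <= a%:~R :> R.
  have [a3|->] : 3 <= a \/ a = 2 by lia.
    by right; rewrite (ler_int R 3).
  by left.
have -> : s%:~R - w * t%:~R = s%:~R - u * t%:~R - (w - u) * t%:~R by ring.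
have sa : t = 1 -> s%:~R - u * t%:~R < a%:~R - u -> s%:~R <= a%:~R - 1 :> R.
  move=> ->; rewrite mulr1 ltrD2r ltr_int => h.
  by rewrite -[1]/(1%:~R) -intrB ler_int; lia.
have t12 : t = 1 \/ 2 <= t%:~R :> R.
  have [->|h] : t = 1 \/ 2 <= t by clear -t0; lia.
    by left.
  by right; rewrite (ler_int R 2).
set r := s%:~R - u * t%:~R in sa * => /andP[r1 rB].
have t1 : 1 <= t%:~R :> R by rewrite (ler_int R 1).
have [D2 D0] : 3 / 2 < w - u /\ (w - u) <= (w - u) * t%:~R.
  split; last by rewrite ler_peMr //; lra.
  by lra.
(* For [r <= -1] both factors are negative and the product is at least [(w - u) t - r], which
   exceeds [w - u]. *)
move: r1; rewrite ler_normr => /orP[] r1; last first.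
  have h : 0 <= (- r - 1) * ((w - u) * t%:~R - r) by apply: mulr_ge0; lra.
  by rewrite ger0_norm; lra.
move: rB sa; rewrite ger0_norm; last by lra.
move=> rB sa; rewrite -normrN -mulrN opprB.
suff : (w - u) / 3 < r * ((w - u) * t%:~R - r).
  by move=> h; apply: lt_le_trans h (ler_norm _).
(* For [t = 1], integrality of [s] gives [r <= a - u - 1], and [h] is the concavity estimate on
   [[1, a - u - 1]]. For [t >= 2] the second factor is already large, because
   [r < a - u <= w - u + 1/2]. *)
case: t12 => [t_1|t2].
  have {}sa := sa t_1 rB; rewrite t_1 mulr1.
  have rB1 : r <= a%:~R - u - 1 by rewrite /r t_1; lra.
  have h : 0 <= (r - 1) * (a%:~R - u - 1 - r) by apply: mulr_ge0; lra.
  (* The tail [w] can lie below [a] only when [a >= 3], since [w >= 2]. *)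
  have [s0|[s0 a3]] : a%:~R - w <= 0 \/ 0 <= a%:~R - w /\ 3 <= a%:~R :> R.
    case: A3 => A3; first by left; lra.
    have [?|?] : a%:~R - w <= 0 \/ 0 <= a%:~R - w by lra.
      by left.
    by right.
    have : 0 <= (r - 1) * (w - a%:~R) by apply: mulr_ge0; lra.
    lra.
  have h2 : 0 <= (a%:~R - u - 1 - r) * (a%:~R - w) by apply: mulr_ge0; lra.
  have h3 : 0 <= (a%:~R - u - 5 / 2) * (2^-1 - (a%:~R - w)) by apply: mulr_ge0; lra.
  lra.
have h : (w - u) * 2 <= (w - u) * t%:~R by rewrite ler_wpM2l //; lra.
have h2 : 0 <= (r - 1) * ((w - u) * t%:~R - r) by apply: mulr_ge0; lra.
lra.
Qed.

Lemma reduced_digitN (R : realType) (a : int) (w u : R) :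
  reduced_digit a w u -> reduced_digit (- a) (- w) (- u).
Proof.
move=> [a2 [wa aw] ua]; split; first by rewrite normrN.
  by split; [rewrite sgzN mulrNz mulrNN | rewrite mulrNz -opprD normrN].
by rewrite /Hinterval sgzN mulrNz mulrNN.
Qed.

(** Here [s] and [t] are the coordinates of a vector in the n-th convergent basis. The reflection
    [z -> -z] reduces to [a > 0], and then negating [s] and [t] together reduces to [t > 0]. *)
Lemma legendre_coord (R : realType) (a s t : int) (w u : R) :
  reduced_digit a w u ->
  1 <= `|s%:~R - u * t%:~R| < `|a%:~R - u| ->
  `|(s%:~R - u * t%:~R) * (s%:~R - w * t%:~R)| <= `|w - u| / 3 -> t = 0.
Proof.
wlog a0 : a t w u / 0 < a.
  move=> H awu; have [a2 _ _] := awu.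
  have [a0|a0] : 0 < a \/ 0 < - a by lia.
    exact: H.
  move=> h1 h2; apply/eqP; rewrite -oppr_eq0; apply/eqP.
  apply: (H (- a) (- t) (- w) (- u)) => //; first exact: reduced_digitN.
    by rewrite !mulrNz !mulrNN -opprD normrN.
  by rewrite !mulrNz !mulrNN -opprD normrN.
move=> awu; have [a2 [wa aw] ua] := awu.
have /andP[l0 l1] := Hlambda_bounds R.
have A2 : 2 <= a%:~R :> R by rewrite (ler_int R 2); lia.
move: wa aw ua; rewrite /Hinterval gtr0_sgz // !mul1r => w2 _ /andP[u0 u1].
rewrite (_ : `|a%:~R - u| = a%:~R - u); last by rewrite gtr0_norm //; lra.
rewrite (_ : `|w - u| = w - u); last by rewrite gtr0_norm //; lra.
move=> h1 h2; case: (ltrgtP t 0) => // t0.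
  have nt0 : 0 < - t by rewrite oppr_gt0.
  have := @legendre_coord_pos _ a (- s) (- t) w u a0 nt0 awu.
  rewrite !mulrNz !mulrN -!opprD normrN mulrNN => /(_ h1).
  by rewrite ltNge h2.
by have := legendre_coord_pos a0 t0 awu h1; rewrite ltNge h2.
Qed.

(** The first vector is the numerator and denominator of [[a_0, ..., a_(n-1)]], starting from [1/0];
    from [n = 1] on, the second is the negative of the preceding first vector. Both are the columns
    of a product of matrices of determinant 1. *)
Fixpoint mcf_basis (a : nat -> int) (n : nat) : (int * int) * (int * int) :=
  if n is m.+1 then
    let: (e, f) := mcf_basis a m in
    ((a m * e.1 + f.1, a m * e.2 + f.2), (- e.1, - e.2))
  else ((1, 0), (0, 1)).

Lemma mcf_basis_det (a : nat -> int) (n : nat) :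
  (mcf_basis a n).1.1 * (mcf_basis a n).2.2 -
  (mcf_basis a n).1.2 * (mcf_basis a n).2.1 = 1.
Proof.
elim: n => [|n] //=; case: (mcf_basis a n) => e f /= <-; ring.
Qed.

Lemma mcf_basis_primitive (a : nat -> int) (n : nat) :
  coprimez (mcf_basis a n).1.1 (mcf_basis a n).1.2.
Proof.
apply/coprimezP; exists ((mcf_basis a n).2.2, - (mcf_basis a n).2.1) => /=.
by rewrite -(mcf_basis_det a n); ring.
Qed.

Definition lform (R : realType) (al be : R) (v : int * int) : R :=
  al * v.1%:~R + be * v.2%:~R.

(** The form [al (p - z q)] vanishes on the direction [(z, 1)]. In the coordinates of the n-th basis
    this direction becomes [(z_n, 1)], with [z_n] the orbit of [z], which fixes the ratio of the two
    values. *)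
Lemma lform_basis (R : realType) (al z : R) (a : nat -> int) (n : nat) :
  (forall j, (a j)%:~R - mcf_orbit a z j != 0) ->
  lform al (- (z * al)) (mcf_basis a n).2 =
  - (mcf_orbit a z n * lform al (- (z * al)) (mcf_basis a n).1).
Proof.
move=> az; elim: n => [|n IHn] /=; first by rewrite /lform /=; ring.
have := az n; move: IHn; case: (mcf_basis a n) => e f /=; rewrite /lform /=.
move: (mcf_orbit a z n) => y IHn y0.
have -> : al * (a n * e.1 + f.1)%:~R + - (z * al) * (a n * e.2 + f.2)%:~R =
   ((a n)%:~R - y) * (al * e.1%:~R + - (z * al) * e.2%:~R).
  by rewrite mulrBl -IHn !intrD !intrM; ring.
by rewrite mulrA mulVf // mul1r !mulrNz; ring.
Qed.

Lemma lform_basisS (R : realType) (al z : R) (a : nat -> int) (n : nat) :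
  (forall j, (a j)%:~R - mcf_orbit a z j != 0) ->
  lform al (- (z * al)) (mcf_basis a n.+1).1 =
  ((a n)%:~R - mcf_orbit a z n) * lform al (- (z * al)) (mcf_basis a n).1.
Proof.
move=> az; have := lform_basis al n az => /=.
case: (mcf_basis a n) => e f /=; rewrite /lform /= => h.
by rewrite mulrBl -h !intrD !intrM; ring.
Qed.

Lemma mcf_basis_coord (a : nat -> int) (n : nat) (v : int * int) :
  exists s t : int, v = (s * (mcf_basis a n).1.1 + t * (mcf_basis a n).2.1,
                         s * (mcf_basis a n).1.2 + t * (mcf_basis a n).2.2).
Proof.
have := mcf_basis_det a n; case: (mcf_basis a n) => e f /= ef; case: v => p q.
exists (p * f.2 - q * f.1), (e.1 * q - e.2 * p).
congr pair.
  by rewrite -[LHS]mulr1 -ef; ring.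
by rewrite -[LHS]mulr1 -ef; ring.
Qed.

Lemma lform_coord (R : realType) (al z : R) (a : nat -> int) (n : nat) (s t : int) :
  (forall j, (a j)%:~R - mcf_orbit a z j != 0) ->
  lform al (- (z * al)) (s * (mcf_basis a n).1.1 + t * (mcf_basis a n).2.1,
                         s * (mcf_basis a n).1.2 + t * (mcf_basis a n).2.2) =
  (s%:~R - mcf_orbit a z n * t%:~R) * lform al (- (z * al)) (mcf_basis a n).1.
Proof.
move=> az; have := lform_basis al n az => /=.
case: (mcf_basis a n) => e f /=; rewrite /lform /= => h.
rewrite !intrD !intrM.
transitivity (s%:~R * (al * e.1%:~R + - (z * al) * e.2%:~R) +
  t%:~R * (al * f.1%:~R + - (z * al) * f.2%:~R)); first by ring.
by rewrite h; ring.
Qed.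

(** * Growth along the expansion *)

Lemma growth_step (R : realType) (a : int) (w u : R) :
  reduced_digit a w u -> 8 / 5 <= `|a%:~R - u|.
Proof.
move=> awu; have [a2 _ _] := awu; have := reduced_digit_gap awu.
have A2 : 2 <= `|a|%:~R :> R by rewrite (ler_int R 2).
by have := Hlambda_bounds R; lra.
Qed.

Lemma growth_gt0 (R : realType) (a : nat -> int) (w u x : nat -> R) (n : nat) :
  (forall j, reduced_digit (a j) (w j) (u j)) ->
  (forall j, x j.+1 = `|(a j)%:~R - u j| * x j) -> 0 < x 0%N -> 0 < x n.
Proof.
move=> red xS x0; elim: n => [//|n IHn]; rewrite xS mulr_gt0 //.
by have := growth_step (red n); lra.
Qed.

(** Each factor satisfies [|a - u| <= |a| + 1 - lambda <= 2 |a| <= exp (log |a| + c0)]. *)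
Lemma growth_upper (R : realType) (a : nat -> int) (w u x : nat -> R) (n : nat) :
  (forall j, reduced_digit (a j) (w j) (u j)) ->
  (forall j, x j.+1 = `|(a j)%:~R - u j| * x j) -> 0 < x 0%N ->
  x n <= x 0%N * expR (alpha R a n + c0 R * n%:R).
Proof.
move=> red xS x0; elim: n => [|n IHn].
  by rewrite /alpha big_ord0 mulr0 addr0 expR0 mulr1.
rewrite /alpha big_ord_recr /= -/(alpha R a n) xS.
have -> : alpha R a n + log_abs R (a n) + c0 R * n.+1%:R =
    (alpha R a n + c0 R * n%:R) + (log_abs R (a n) + c0 R).
  by rewrite -natr1; ring.
rewrite expRD mulrA mulrC ler_pM //.
  exact/ltW/(growth_gt0 _ red).
have [a2 _ _] := red n; have := reduced_digit_gap (red n).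
have A2 : 2 <= `|a n|%:~R :> R by rewrite (ler_int R 2).
have c2 : 2 <= expR (c0 R).
  by rewrite -[leLHS](@lnK R) ?posrE // ler_expR; exact: c0_ge.
rewrite expRD /log_abs lnK ?posrE; last by lra.
have := Hlambda_bounds R; move: (expR _) c2 (`|a n|%:~R) A2 => c c2 A A2.
have : 0 <= A * (c - 2) by apply: mulr_ge0; lra.
lra.
Qed.

(* Pointwise [|a - u|] may fall short of [exp (log |a| - chi)], but only when
   |a| = 2 and u is on the side of a, which forces the preceding digit to be
   at least 3 in absolute value: the factor 4/5 records the slack gained there. *)
Lemma growth_lower (R : realType) (a : nat -> int) (w u x : nat -> R) (n : nat) :
  (forall j, reduced_digit (a j) (w j) (u j)) ->
  (forall j, `|a j| = 2 -> a j * a j.+1 < 0) ->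
  (forall j, u j.+1 = ((a j)%:~R - u j)^-1) ->
  (forall j, x j.+1 = `|(a j)%:~R - u j| * x j) -> 0 < x 0%N ->
  (if 0 < (sgz (a n))%:~R * u n then 1 else 4 / 5) * x 0%N * expR (omega R a n)
    <= x n.
Proof.
move=> red ab uS xS x0; elim: n => [|n IH].
  rewrite /omega big_ord0 expR0 mulr1 ler_piMl ?(ltW x0) //.
  by case: ifP => _; lra.
rewrite [in leRHS]xS /omega big_ord_recr /= -/(omega R a n) expRD.
have [a2 [_ _] /andP[u0 u1]] := red n; have /andP[g0 _] := reduced_digit_gap (red n).
have A2 : 2 <= `|a n|%:~R :> R by rewrite (ler_int R 2).
have /andP[l0 l1] := Hlambda_bounds R.
move: IH; have := log_abs_chi_le R a2.
have := expR_gt0 (omega R a n); have := expR_gt0 (log_abs R (a n) - chi R (a n)).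
move: (expR (omega R a n)) (expR _) => W c c0 W0.
have xW : 0 < x 0%N * W by rewrite mulr_gt0.
(* For [|a| >= 3] the factor [|a - u| >= |a| - 2/5] beats [|a|/2] by more than 5/4, so the full
   constant 1 is recovered whatever the previous state. *)
case: ifPn => [a3 ca|].
  have A3 : 3 <= `|a n|%:~R :> R by rewrite (ler_int R 3).
  move: g0 A3 ca; move: (`|a n|%:~R) (`|_ - _|) => A G g0 A3 ca IH.
  have h1 : 4 / 5 * (x 0%N * W) <= x n.
    apply: le_trans IH; rewrite -[leRHS]mulrA ler_pM2r //.
    by case: ifP => _; lra.
  have h2 : x 0%N * W * c <= x 0%N * W * (A / 2) by rewrite ler_pM2l.
  have h3 : (A - 2 / 5) * (4 / 5 * (x 0%N * W)) <= G * x n.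
    by apply: ler_pM => //; nra.
  apply: (@le_trans _ _ (x 0%N * W * c)).
    rewrite -[leRHS]mulrA ler_pM2r ?(mulr_gt0 W0 c0) // ler_piMl ?(ltW x0) //.
    by case: ifP => _; lra.
  nra.
rewrite -ltNge => a3 c2; have a_2 : `|a n| = 2 by clear -a2 a3; lia.
(* After a digit of absolute value 2 the next [u] lies on the side opposite to the next digit, so
   only the constant 4/5 has to be reached. *)
have -> : (0 < (sgz (a n.+1))%:~R * u n.+1) = false.
  apply/negbTE; rewrite -leNgt uS; move: (ab n a_2) u0 u1.
  case: (digit_sign R a2) => -[a0 [-> ha]].
    rewrite pmulr_rlt0 // => b0 u0 u1.
    rewrite ltr0_sgz // mulrN1z mulN1r oppr_le0 invr_ge0.
    by lra.
  rewrite nmulr_rlt0 // => b0 u0 u1; rewrite gtr0_sgz // mul1r invr_le0.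
  by lra.
have h4 : 4 / 5 * x 0%N * (W * c) <= 8 / 5 * (x 0%N * W) by nra.
move=> IH; apply: le_trans h4 _.
(* With [u] on the side of [a], the constant drops from 1 to 4/5 and the factor 8/5 suffices;
   otherwise the constant stays 4/5 and [|a - u| >= 2]. *)
move: IH; case: ifPn => su IH.
  by have := growth_step (red n) => hG; rewrite mul1r in IH; apply: ler_pM => //; lra.
have hG : 2 <= `|(a n)%:~R - u n|.
  move: su; rewrite -leNgt.
  case: (digit_sign R a2) => -[_ [-> ha]] su; first by rewrite ger0_norm; lra.
  by rewrite ler0_norm; lra.
have : 2 * (4 / 5 * x 0%N * W) <= `|(a n)%:~R - u n| * x n.
  by apply: ler_pM => //; lra.
lra.
Qed.

(** Bernoulli's inequality: a linear lower bound on the growth is enough. *)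
Lemma geometric_unbounded (R : realType) (x : nat -> R) (K : R) :
  (forall j, 8 / 5 * x j <= x j.+1) -> 0 < x 0%N -> exists n, K < x n.
Proof.
move=> xS x0.
have h n : x 0%N * (1 + n%:R * (3 / 5)) <= x n.
  elim: n => [|n IHn]; first by rewrite mul0r addr0 mulr1.
  apply: le_trans (xS n); rewrite -natr1.
  have : 0 <= x 0%N * n%:R by rewrite mulr_ge0 // ltW.
  nra.
exists (Num.truncn (`|K| / x 0%N * 2)).+1.
apply: lt_le_trans (h _).
have := truncnS_gt (`|K| / x 0%N * 2); set m := (Num.truncn _).+1%:R => hm.
have : `|K| * 2 < x 0%N * m.
  rewrite -ltr_pdivrMl //; apply: le_lt_trans hm; rewrite le_eqVlt.
  by apply/orP; left; apply/eqP; ring.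
by have := ler_norm K; have := normr_ge0 K; lra.
Qed.

Lemma growth_interval (R : realType) (x : nat -> R) (y : R) :
  (forall j, 8 / 5 * x j <= x j.+1) -> 0 < x 0%N -> x 0%N <= y ->
  exists n, x n <= y < x n.+1.
Proof.
move=> xS x0 xy; have h := geometric_unbounded y xS x0.
case: (ex_minnP h) => -[|n] yn min; first by move: yn; lra.
by exists n; rewrite yn andbT leNgt; apply/negP => /min; rewrite ltnn.
Qed.

(** * Vectors with small values of the form *)

Lemma ord2_lift0 : lift ord0 ord0 = 1 :> 'I_2. Proof. exact/val_inj. Qed.

Lemma det2 (R : comPzRingType) (g : 'M[R]_2) :
  \det g = g 0 0 * g 1 1 - g 0 1 * g 1 0.
Proof.
rewrite (expand_det_row _ ord0) !big_ord_recl big_ord0 /cofactor !det_mx11 !mxE /=.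
rewrite !ord2_lift0 /=.
have -> : lift 1 ord0 = 0 :> 'I_2 by exact/val_inj.
by rewrite expr0 expr1; ring.
Qed.

Lemma invmx2_mul (R : realType) (g : 'M[R]_2) (v : 'cV[R]_2) : \det g = 1 ->
  (invmx g *m v) 0 0 = g 1 1 * v 0 0 - g 0 1 * v 1 0 /\
  (invmx g *m v) 1 0 = g 0 0 * v 1 0 - g 1 0 * v 0 0.
Proof.
move=> g1; have gU : g \in unitmx by rewrite unitmxE g1 unitr1.
pose w : 'cV[R]_2 := \col_(i < 2)
  (if i == 0 then g 1 1 * v 0 0 - g 0 1 * v 1 0
   else g 0 0 * v 1 0 - g 1 0 * v 0 0).
have gw : g *m w = v.
  rewrite det2 in g1.
  apply/matrixP => i j; rewrite ord1 !mxE !big_ord_recl big_ord0 !mxE /= addr0.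
  rewrite ord2_lift0.
  have [->|->] : i = 0 \/ i = 1.
    by case: i => -[|[|//]] hi; [left|right]; exact/val_inj.
  - by rewrite -[RHS]mul1r -g1; ring.
  - by rewrite -[RHS]mul1r -g1; ring.
by have <- : w = invmx g *m v; [rewrite -gw mulKmx|rewrite !mxE].
Qed.

Lemma Lminus_pair (R : realType) (g : 'M[R]_2) (p : int * int) : \det g = 1 ->
  Lminus g (pair_vec R p) = lform (g 1 1) (- g 0 1) p.
Proof.
by move=> g1; rewrite /Lminus (invmx2_mul _ g1).1 !mxE /lform /= mulNr.
Qed.

Lemma Qform_pair (R : realType) (g : 'M[R]_2) (p : int * int) : \det g = 1 ->
  Qform g (pair_vec R p) =
  lform (g 1 1) (- g 0 1) p * lform (- g 1 0) (g 0 0) p.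
Proof.
move=> g1; rewrite /Qform /Q0 (invmx2_mul _ g1).1 (invmx2_mul _ g1).2 !mxE /lform /=.
by rewrite !mulNr [- _ + _]addrC.
Qed.

Lemma normr_lform_le_enorm (R : realType) (al be : R) (p : int * int) :
  `|lform al be p| <= (`|al| + `|be|) * enorm (pair_vec R p).
Proof.
rewrite /enorm !mxE /= /lform; set x : R := p.1%:~R; set y : R := p.2%:~R.
have hx : `|x| <= Num.sqrt (x ^+ 2 + y ^+ 2).
  by rewrite -sqrtr_sqr ler_wsqrtr // lerDl sqr_ge0.
have hy : `|y| <= Num.sqrt (x ^+ 2 + y ^+ 2).
  by rewrite -sqrtr_sqr ler_wsqrtr // lerDr sqr_ge0.
rewrite (le_trans (ler_normD _ _)) // !normrM mulrDl lerD // ler_wpM2l //.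
Qed.

Lemma enorm_le_lform (R : realType) (g : 'M[R]_2) (p : int * int) : \det g = 1 ->
  enorm (pair_vec R p) <= (`|g 0 0| + `|g 0 1| + `|g 1 0| + `|g 1 1|) *
    (`|lform (g 1 1) (- g 0 1) p| + `|lform (- g 1 0) (g 0 0) p|).
Proof.
rewrite det2 => g1; set X := lform _ _ p; set Y := lform _ _ p.
have p1 : p.1%:~R = g 0 0 * X + g 0 1 * Y.
  by rewrite /X /Y /lform -[LHS]mul1r -g1; ring.
have p2 : p.2%:~R = g 1 0 * X + g 1 1 * Y.
  by rewrite /X /Y /lform -[LHS]mul1r -g1; ring.
rewrite /enorm !mxE /= p1 p2.
move: X Y {p1 p2} (g 0 0) (g 0 1) (g 1 0) (g 1 1) {g1} => X Y a b c d.
apply: (@le_trans _ _ (`|a * X + b * Y| + `|c * X + d * Y|)).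
  rewrite -[leRHS]ger0_norm ?addr_ge0 // -sqrtr_sqr ler_wsqrtr //.
  rewrite -[X in X + _ <= _]real_normK ?num_real //.
  rewrite -[X in _ + X <= _]real_normK ?num_real //.
  have := normr_ge0 (a * X + b * Y); have := normr_ge0 (c * X + d * Y).
  by move: `|_| `|_| => s t s0 t0; have := mulr_ge0 s0 t0; lra.
apply: (@le_trans _ _ (`|a| * `|X| + `|b| * `|Y| + (`|c| * `|X| + `|d| * `|Y|))).
  by rewrite lerD // (le_trans (ler_normD _ _)) // !normrM.
have := mulr_ge0 (normr_ge0 a) (normr_ge0 Y).
have := mulr_ge0 (normr_ge0 b) (normr_ge0 X).
have := mulr_ge0 (normr_ge0 c) (normr_ge0 Y).
have := mulr_ge0 (normr_ge0 d) (normr_ge0 X).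
lra.
Qed.

(** The values of the two coordinate forms on the n-th basis form a matrix of determinant 1. Its
    second column is obtained from the first by the factors [-u_n] and [-w_n], so the determinant is
    the product on the left. *)
Lemma mcf_basis_Q (R : realType) (g : 'M[R]_2) (a : nat -> int) (w u : R) (n : nat) :
  \det g = 1 -> g 0 1 = u * g 1 1 -> g 0 0 = w * g 1 0 ->
  (forall j, (a j)%:~R - mcf_orbit a w j != 0) ->
  (forall j, (a j)%:~R - mcf_orbit a u j != 0) ->
  lform (g 1 1) (- g 0 1) (mcf_basis a n).1 *
  lform (- g 1 0) (g 0 0) (mcf_basis a n).1 *
  (mcf_orbit a u n - mcf_orbit a w n) = 1.
Proof.
rewrite det2 => g1 gu gw aw au.
have hu := lform_basis (g 1 1) n au; have hw := lform_basis (- g 1 0) n aw.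
rewrite mulrN opprK -gw in hw; rewrite -gu in hu.
have := congr1 (intr : int -> R) (mcf_basis_det a n).
move: hu hw; case: (mcf_basis a n) => e f /=; rewrite /lform /=.
move=> hu hw; rewrite intrB !intrM mulr1z => ef.
set X := g 1 1 * e.1%:~R + _ in hu *; set Y := _ + g 0 0 * e.2%:~R in hw *.
have -> : X * Y * (mcf_orbit a u n - mcf_orbit a w n) =
  X * - (mcf_orbit a w n * Y) - - (mcf_orbit a u n * X) * Y by ring.
transitivity ((g 0 0 * g 1 1 - g 0 1 * g 1 0) *
  (e.1%:~R * f.2%:~R - e.2%:~R * f.1%:~R)); last by rewrite g1 ef mulr1.
by rewrite -hu -hw /X /Y; ring.
Qed.

Lemma coprimez_scale (s p q : int) : coprimez (s * p) (s * q) -> s = 1 \/ s = -1.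
Proof.
move=> /eqP h.
have : (s %| gcdz (s * p) (s * q))%Z by rewrite dvdz_gcd !dvdz_mulr.
by rewrite h dvdz1; lia.
Qed.

(** Choose [n] so that the first coordinate of [v] lies between those of [E_n] and [E_(n+1)] in
    absolute value. In the n-th basis [legendre_coord] then forces [v = s E_n], and primitivity
    forces [s] to be 1 or -1. *)
Lemma legendre (R : realType) (g : 'M[R]_2) (a : nat -> int) (w u : R)
    (v : int * int) :
  \det g = 1 -> g 0 1 = u * g 1 1 -> g 0 0 = w * g 1 0 ->
  (forall j, (a j)%:~R - mcf_orbit a w j != 0) ->
  (forall j, (a j)%:~R - mcf_orbit a u j != 0) ->
  (forall j, reduced_digit (a j) (mcf_orbit a w j) (mcf_orbit a u j)) ->
  primitive_pairs v -> `|Qform g (pair_vec R v)| <= 3^-1 ->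
  `|g 1 1| <= `|Lminus g (pair_vec R v)| ->
  exists n, v = (mcf_basis a n).1 \/
            v = (- (mcf_basis a n).1.1, - (mcf_basis a n).1.2).
Proof.
move=> g1 gu gw aw au red v1; rewrite Qform_pair // Lminus_pair // => Qv Lv.
pose x n := `|lform (g 1 1) (- g 0 1) (mcf_basis a n).1|.
have xS n : x n.+1 = `|(a n)%:~R - mcf_orbit a u n| * x n.
  by rewrite /x {1}gu lform_basisS // -gu normrM.
have x0E : x 0%N = `|g 1 1| by rewrite /x /lform /= mulr1 mulr0 addr0.
have x0 : 0 < x 0%N.
  rewrite x0E normr_gt0; apply: contra_eqN g1 => /eqP d0.
  by rewrite det2 gu d0 !mulr0 mul0r subr0 eq_sym oner_eq0.
have xpos n : 0 < x n := growth_gt0 n red xS x0.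
have [n /andP[n1 n2]] : exists n, x n <= `|lform (g 1 1) (- g 0 1) v| < x n.+1.
  apply: growth_interval => [j|//|]; last by rewrite x0E.
  by rewrite xS ler_pM2r // (growth_step (red j)).
exists n; have [s [t vE]] := mcf_basis_coord a n v.
have := lform_coord (g 1 1) n s t au; rewrite -vE -gu => Xv.
have := lform_coord (- g 1 0) n s t aw; rewrite -vE mulrN opprK -gw => Yv.
have QE := mcf_basis_Q n g1 gu gw aw au.
rewrite Xv normrM -/(x n) in n1 n2.
have t0 : t = 0.
  apply: (legendre_coord (s := s) (red n)).
    apply/andP; split; first by rewrite -(ler_pM2r (xpos n)) mul1r.
    by rewrite -(ltr_pM2r (xpos n)) -xS.
  (* Dividing by [Q(E_n)], that is, multiplying by [u_n - w_n], turns the value of [Q] at [v] into a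
     product of coordinates, so the bound 1/3 on [|Q(v)|] becomes [|w_n - u_n| / 3]. *)
  have -> : (s%:~R - mcf_orbit a u n * t%:~R) * (s%:~R - mcf_orbit a w n * t%:~R) =
      lform (g 1 1) (- g 0 1) v * lform (- g 1 0) (g 0 0) v *
      (mcf_orbit a u n - mcf_orbit a w n).
    by rewrite -[LHS]mulr1 -[X in _ * X = _]QE Xv Yv; ring.
  by rewrite normrM distrC mulrC ler_wpM2l.
move: vE v1; rewrite t0 !mul0r !addr0 => -> /coprimez_scale [->|->].
  by left; rewrite !mul1r; case: (mcf_basis a n).1.
by right; rewrite !mulN1r.
Qed.

(** * Counting *)

Lemma subz_le_slack (m k p q : nat) :
  (m <= k + p)%N -> m%:Z - (p + q)%N%:Z <= k%:Z.
Proof. by lia. Qed.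

Lemma lez_add_slack (m k p q : nat) :
  (m <= k + q)%N -> m%:Z <= k%:Z + (p + q)%N%:Z.
Proof. by lia. Qed.

Lemma lformN (R : realType) (al be : R) (v : int * int) :
  lform al be (- v.1, - v.2) = - lform al be v.
Proof. by rewrite /lform /= !mulrNz !mulrN opprD. Qed.

(** Membership in [Gset] requires a positive first coordinate, so at most one of [E_n] and [-E_n]
    can be counted; this selects it. *)
Definition pos_convergent (R : realType) (al be : R) (a : nat -> int) (n : nat) :
    int * int :=
  let e := (mcf_basis a n).1 in
  if 0 < lform al be e then e else (- e.1, - e.2).

Lemma lform_pos_convergent (R : realType) (al be : R) (a : nat -> int) (n : nat) :
  lform al be (pos_convergent al be a n) = `|lform al be (mcf_basis a n).1|.
Proof.
rewrite /pos_convergent; case: (ltrP 0) => h; first by rewrite gtr0_norm.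
by rewrite lformN ler0_norm.
Qed.

Lemma normr_lform_pos_convergent (R : realType) (al be al' be' : R)
    (a : nat -> int) (n : nat) :
  `|lform al' be' (pos_convergent al be a n)| = `|lform al' be' (mcf_basis a n).1|.
Proof. by rewrite /pos_convergent; case: ifP => // _; rewrite lformN normrN. Qed.

Lemma pos_convergent_primitive (R : realType) (al be : R) (a : nat -> int) (n : nat) :
  primitive_pairs (pos_convergent al be a n).
Proof.
have := mcf_basis_primitive a n; rewrite /primitive_pairs /pos_convergent /=.
by case: ifP => //= _; rewrite coprimezN coprimeNz.
Qed.

Lemma card_ord_count (n : nat) (P : pred nat) :
  #|[pred j : 'I_n | P j]| = size [seq j <- iota 0 n | P j].
Proof.
rewrite size_filter -sum1_card -sum1_count -[X in iota 0 X]subn0.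
by rewrite -/(index_iota 0 n) big_mkord.
Qed.

Lemma size_filter_tail (n N : nat) (P : pred nat) :
  (size [seq j <- iota 0 n | P j] <=
   size [seq j <- iota 0 n | P j && (N <= j)] + N)%N.
Proof.
rewrite -[X in (_ <= _ + X)%N](size_iota 0 N) -size_cat.
apply: uniq_leq_size; first by rewrite filter_uniq // iota_uniq.
move=> j; rewrite mem_filter mem_cat mem_filter !mem_iota /= add0n => /andP[-> ->].
by case: leqP; rewrite ?orbT.
Qed.

Theorem theorem4p1 (R : realType) (g : 'M[R]_2) (xi : R) (a : nat -> int)
    (delta kappa : R) :
  \det g = 1 ->
  Hreduced g ->
  mobius_bd g None = Some xi ->
  irrational xi ->
  is_minus_cf a xi ->
  0 < delta < Num.sqrt (2 / pi) ->
  0 < kappa ->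
  exists (theta : R) (nu : nat),
    0 <= theta /\
    forall (n : nat) (rho : R), 0 < rho ->
      (alpha R a n + c0 R * n%:R + theta <= ln rho ->
         (e_count a delta n)%:Z - nu%:Z
           <= (#|` fset_set (Gset g delta kappa rho)|)%:Z) /\
      (ln rho <= omega R a n - theta ->
         (#|` fset_set (Gset g delta kappa rho)|)%:Z
           <= (f_count a delta n)%:Z + nu%:Z).
Proof.
move=> g1 gred gxi xQ acf /andP[d0 dpi] k0.
have [g10 gw] : g 1 0 != 0 /\ g 0 0 = xi * g 1 0.
  move: gxi; rewrite /mobius_bd; case: eqP => // /eqP g10 [<-].
  by rewrite divfK.
move: gred; rewrite /Hreduced gxi /mobius_bd !mulr0 !add0r.
case: eqP => // /eqP g11 /= [_]; set u := g 0 1 / g 1 1 => hu.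
have gu : g 0 1 = u * g 1 1 by rewrite divfK.
pose w_ := mcf_orbit a xi; pose u_ := mcf_orbit a u.
have red j : reduced_digit (a j) (w_ j) (u_ j) by exact: reduced_digit_orbit.
have au j : (a j)%:~R - u_ j != 0.
  by rewrite -normr_gt0; have := growth_step (red j); lra.
have aw j : (a j)%:~R - w_ j != 0.
  have [_ [h _] _] := red j.+1; apply: contraTneq h => h0.
  by rewrite /w_ /= -/w_ h0 invr0 mulr0; lra.
pose X := lform (g 1 1) (- g 0 1); pose Y := lform (- g 1 0) (g 0 0).
pose x n : R := `|X (mcf_basis a n).1|.
have xS n : x n.+1 = `|(a n)%:~R - u_ n| * x n.
  by rewrite /x /X {1}gu lform_basisS // -gu normrM.
have x0 : 0 < x 0%N by rewrite /x /X /lform /= mulr1 mulr0 addr0 normr_gt0.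
have xpos n : 0 < x n := growth_gt0 n red xS x0.
have xS85 j : 8 / 5 * x j <= x j.+1 by rewrite xS ler_pM2r // (growth_step (red j)).
have xlt : {homo x : i j / (i < j)%N >-> i < j}.
  by apply: homo_ltn => [? ? ?|i]; [exact: lt_trans|have := xS85 i; have := xpos i; lra].
have xle : {homo x : i j / (i <= j)%N >-> i <= j}.
  by move=> i j; rewrite leq_eqVlt => /predU1P[->//|/xlt/ltW].
pose f := pos_convergent (g 1 1) (- g 0 1) a.
have Xf j : X (f j) = x j by exact: lform_pos_convergent.
have width_ge1 j : 1 <= `|w_ j - u_ j|.
  have /andP[+ _] := reduced_digit_width (red j); have /andP[_ l1] := Hlambda_bounds R.
  have [a2 _ _] := red j; have A2 : 2 <= `|a j|%:~R :> R by rewrite (ler_int R 2).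
  lra.
have xY j : x j * `|Y (f j)| = `|w_ j - u_ j|^-1.
  rewrite normr_lform_pos_convergent /x -normrM distrC -normfV; congr `|_|.
  apply: (mulIf (x := u_ j - w_ j)).
    by rewrite -normr_gt0 distrC; have := width_ge1 j; lra.
  by rewrite mcf_basis_Q // mulVf // -normr_gt0 distrC; have := width_ge1 j; lra.
have Qf j : `|Qform g (pair_vec R (f j))| = `|w_ j - u_ j|^-1.
  by rewrite Qform_pair // normrM -/(X _) -/(Y _) Xf gtr0_norm.
have small_iff j :
    (`|w_ j - u_ j|^-1 < delta ^+ 2 / 2) = (2 * delta ^- 2 < `|w_ j - u_ j|).
  have W0 : 0 < `|w_ j - u_ j| by have := width_ge1 j; lra.
  have D0 : 0 < delta ^+ 2 / 2 by rewrite divr_gt0 // exprn_gt0.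
  by rewrite -[RHS]ltf_pV2 ?posrE ?divr_gt0 ?exprn_gt0 // invf_div.
(* The hypothesis on [delta] gives [delta^2 / 2 < 1/pi], which is below the threshold 1/3 of
   [legendre]. *)
have dlt : delta ^+ 2 / 2 <= 3^-1.
  have p0 := pi_gt0 R; have p3 := pi_ge3 R.
  have h : delta ^+ 2 <= 2 / pi.
    rewrite -[leRHS]sqr_sqrtr; last by rewrite divr_ge0 // ltW.
    by rewrite ler_pXn2r // ?nnegrE ?sqrtr_ge0 // ltW.
  have h2 : pi^-1 <= 3^-1 :> R by rewrite lef_pV2 ?posrE.
  lra.
pose C : R := 1 + (`|g 0 0| + `|g 0 1| + `|g 1 0| + `|g 1 1|).
have C0 : 0 < C.
  rewrite /C; have := normr_ge0 (g 0 0); have := normr_ge0 (g 0 1).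
  by have := normr_ge0 (g 1 0); have := normr_ge0 (g 1 1); lra.
have normC p : enorm (pair_vec R p) <= C * (`|X p| + `|Y p|).
  apply: (le_trans (enorm_le_lform p g1)); rewrite ler_wpM2r ?addr_ge0 //.
  by rewrite /C; lra.
have XC p : X p <= C * enorm (pair_vec R p).
  apply: (le_trans (ler_norm _)); apply: (le_trans (normr_lform_le_enorm _ _ _)).
  rewrite ler_wpM2r ?sqrtr_ge0 // normrN /C.
  by have := normr_ge0 (g 0 0); have := normr_ge0 (g 1 0); lra.
(* From the index [N] on, the convergents satisfy [L^- > kappa]; the earlier ones are absorbed in
   [nu]. *)
have [N xN] := geometric_unbounded kappa xS85 x0.
(* Vectors with first coordinate below [x 0] escape [legendre]. Their second coordinate is below
   [delta^2 / (2 kappa)] in absolute value, so all of them lie in the finite list [L0], whatever [n]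
   and [rho] are. *)
pose rho0 : R := C * (x 0%N + delta ^+ 2 / 2 / kappa).
pose L0 := enum_fset (fset_set (Gset g delta kappa rho0)).
pose K : R := C * (1 + (x 0%N ^+ 2)^-1) * x 0%N.
have K0 : 0 < K.
  by rewrite /K !mulr_gt0 // ltr_pwDl // invr_ge0 sqr_ge0.
have memG rho p :
    (p \in fset_set (Gset g delta kappa rho)) = (p \in Gset g delta kappa rho).
  by rewrite in_fset_set //; exact: finite_Gset.
(* The first term pays for comparing the norm of a convergent with [exp (alpha + c0 n)], the second
   for comparing [rho] with [exp omega]. *)
pose theta : R := `|ln K| + `|ln (2 * C / x 0%N)|.
have lower n (rho : R) : 0 < rho -> alpha R a n + c0 R * n%:R + theta <= ln rho ->
    (e_count a delta n <= #|` fset_set (Gset g delta kappa rho)| + N)%N.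
  move=> rho_gt0 hrho.
  pose big j := 2 * delta ^- 2 + 2^-1 + Hlambda R < (`|a j|%:~R : R).
  rewrite /e_count (card_ord_count n big).
  apply: (leq_trans (size_filter_tail n N big)); rewrite leq_add2r.
  (* Distinct indices give distinct vectors because [x] is strictly increasing. *)
  rewrite -(size_map f); apply: uniq_leq_size.
    rewrite map_inj_uniq ?filter_uniq ?iota_uniq // => i j fij.
    have : x i = x j by rewrite -!Xf fij.
    by case: (ltngtP i j) => [/xlt + e|/xlt + e|//]; rewrite e ltxx.
  move=> p /mapP[j]; rewrite mem_filter mem_iota add0n => /andP[/andP[bj Nj] /= jn] ->.
  rewrite memG inE; split.
  + exact: pos_convergent_primitive.
  + rewrite Qf invr_gt0 small_iff; have /andP[h _] := reduced_digit_width (red j).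
    by move: bj; rewrite /big => bj; apply/andP; split; have := width_ge1 j; lra.
  + by rewrite Lminus_pair // -/(X _) Xf (lt_le_trans xN) // xle.
  apply: (le_trans (normC _)); rewrite Xf (gtr0_norm (xpos j)).
  (* Since [x j * |Y| <= 1] and [x j >= x 0], the second coordinate is bounded by a constant
     multiple of the first, which alone controls the norm. *)
  have Yj : `|Y (f j)| <= (x 0%N ^+ 2)^-1 * x j.
    rewrite -(ler_pM2l (xpos j)) xY.
    apply: (@le_trans _ _ 1); first by rewrite invf_le1 //; have := width_ge1 j; lra.
    rewrite mulrC -mulrA ler_pdivlMl ?exprn_gt0 // mulr1 expr2.
    by apply: ler_pM => //; [exact/ltW|exact/ltW|exact: xle|exact: xle].
  apply: (@le_trans _ _ (C * (1 + (x 0%N ^+ 2)^-1) * x n)).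
    rewrite -mulrA ler_pM2l // mulrDl mul1r.
    have h := xle _ _ (ltnW jn); have q0 : 0 <= (x 0%N ^+ 2)^-1 by rewrite invr_ge0 sqr_ge0.
    by apply: lerD => //; apply: (le_trans Yj); rewrite ler_wpM2l.
  have CK : 0 < C * (1 + (x 0%N ^+ 2)^-1).
    by rewrite mulr_gt0 // ltr_pwDl // invr_ge0 sqr_ge0.
  apply: (@le_trans _ _ (K * expR (alpha R a n + c0 R * n%:R))).
    rewrite /K -[leRHS]mulrA ler_pM2l //.
    exact: growth_upper red xS x0.
  rewrite -[leRHS](@lnK R) ?posrE // -[X in X * _](@lnK R) ?posrE // -expRD ler_expR.
  have := ler_norm (ln K); have := normr_ge0 (ln (2 * C / x 0%N)).
  by rewrite /theta in hrho; lra.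
have upper n (rho : R) : 0 < rho -> ln rho <= omega R a n - theta ->
    (#|` fset_set (Gset g delta kappa rho)| <= f_count a delta n + size L0)%N.
  move=> rho_gt0 hrho.
  pose small j := 2 * delta ^- 2 - 3 / 2 + Hlambda R < (`|a j|%:~R : R).
  rewrite /f_count (card_ord_count n small) -(size_map f) -size_cat.
  apply: uniq_leq_size => [|p]; first exact: fset_uniq.
  rewrite memG inE mem_cat => -[p1 /andP[Q0 Q1] pk prho].
  have Lp : Lminus g (pair_vec R p) = X p by exact: Lminus_pair.
  have Xp : 0 < X p by rewrite -Lp (lt_trans k0).
  have [xp|px] := lerP (x 0%N) (X p); last first.
    apply/orP; right; rewrite /L0 memG inE; split=> //; first by rewrite Q0.
    apply: (le_trans (normC p)); rewrite ler_pM2l // lerD //.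
      by rewrite gtr0_norm // ltW.
    move: Q1; rewrite Qform_pair // -/(X p) -/(Y p) normrM (gtr0_norm Xp) => Q1.
    rewrite ler_pdivlMr // mulrC.
    apply: le_trans (ltW Q1); rewrite ler_wpM2r // -Lp ltW //.
  apply/orP; left.
  have [j pj] : exists j, p = f j.
    have [||j] := @legendre _ g a xi u p g1 gu gw aw au red p1 _ _.
    - by rewrite (le_trans (ltW Q1)).
    - by rewrite Lp (gtr0_norm Xp); move: xp; rewrite /x /X /lform /= mulr1 mulr0 addr0.
    move=> pE; exists j; rewrite /f /pos_convergent -/X.
    case: pE Xp => ->; first by rewrite -/X => ->.
    by rewrite /X lformN -/X oppr_gt0 => h; rewrite ltNge ltW.
  apply/mapP; exists j => //; rewrite mem_filter mem_iota add0n /=.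
  apply/andP; split.
    move: Q1; rewrite pj Qf small_iff => Q1.
    by have /andP[_ h] := reduced_digit_width (red j); rewrite /small; lra.
  (* If [j >= n], then [x n <= x j <= C rho], whereas the lower growth bound and the choice of
     [theta] give [x n >= 8/5 C rho]. The factor 2 in [theta] is there to outweigh the 4/5. *)
  rewrite ltnNge; apply/negP => nj.
  have [_ ab _] := acf.
  have low := growth_lower n red ab (fun j => erefl) xS x0.
  have {}low : 4 / 5 * x 0%N * expR (omega R a n) <= x n.
    apply: le_trans low; rewrite ler_pM2r ?expR_gt0 // ler_pM2r //.
    by case: ifP => _; lra.
  have h1 : x n <= C * rho.
    apply: (le_trans (xle _ _ nj)); rewrite -Xf -pj.
    by apply: (le_trans (XC p)); rewrite ler_pM2l.
  have h2 : rho * (2 * C / x 0%N) <= expR (omega R a n).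
    have c0 : 0 < 2 * C / x 0%N by rewrite divr_gt0 // mulr_gt0.
    rewrite -[X in X * _](@lnK R) ?posrE // -[X in _ * X](@lnK R) ?posrE //.
    rewrite -expRD ler_expR.
    have := ler_norm (ln (2 * C / x 0%N)); have := normr_ge0 (ln K).
    by rewrite /theta in hrho; lra.
  have h3 : 4 / 5 * x 0%N * (rho * (2 * C / x 0%N)) <= C * rho.
    apply: le_trans h1; apply: le_trans low.
    by rewrite ler_pM2l // mulr_gt0.
  have h4 : 4 / 5 * x 0%N * (rho * (2 * C / x 0%N)) = 8 / 5 * (C * rho).
    by field; rewrite gt_eqF.
  have h5 : 0 < C * rho by rewrite mulr_gt0.
  lra.
exists theta, (N + size L0)%N; split; first by rewrite addr_ge0.
move=> n rho rho_gt0; move: (lower n rho rho_gt0) (upper n rho rho_gt0).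
move: (e_count _ _ _) (f_count _ _ _) #|` _| (size L0) => e e' c l h_low h_up.
split=> [/h_low|/h_up]; [exact: subz_le_slack|exact: lez_add_slack].
Qed.
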